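(* The satisfiability problem for Strategy Logic (SL) on finite models — deciding, given an SL sentence $\varphi$, whether there exists a concurrent game structure $G$ with finitely many actions and finitely many states such that $G\models\varphi$ — is undecidable.
   Context: Concurrent game structures (CGS) $G=(\mathrm{AP},\mathrm{Ag},\mathrm{Ac},\mathrm{St},\lambda,\tau,s_0)$: finite non-empty sets of atomic propositions and agents, countable non-empty sets of actions and states, initial state $s_0$, labeling $\lambda:\mathrm{St}\to2^{\mathrm{AP}}$, transition function $\tau:\mathrm{St}\times\mathrm{Ac}^{\mathrm{Ag}}\to\mathrm{St}$. A CGS is finite if both $\mathrm{Ac}$ and $\mathrm{St}$ are finite. Strategy Logic (SL) formulas: $\varphi::=p\mid\neg\varphi\mid\varphi\wedge\varphi\mid\varphi\vee\varphi\mid\mathsf{X}\varphi\mid\varphi\mathsf{U}\varphi\mid\varphi\mathsf{R}\varphi\mid\langle\langle x\rangle\rangle\varphi\mid[\![x]\!]\varphi\mid(a,x)\varphi$, where $\langle\langle x\rangle\rangle$ / $[\![x]\!]$ quantify existentially/universally over strategies (maps from finite histories of states to actions) assigned to variable $x$, $(a,x)$ binds agent $a$ to the strategy of $x$, and temporal operators are evaluated as in LTL along the unique play determined by the strategies bound to all agents; a sentence $\varphi$ holds in $G$ iff it holds at $s_0$ under the empty assignment. *)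

(* Defs.v *)
From mathcomp Require Import all_boot finmap.

Set Implicit Arguments.
Unset Strict Implicit.
Unset Printing Implicit Defensive.

Local Open Scope fset_scope.

Definition upd (T : eqType) (U : Type) (f : T -> U) (x : T) (u : U) : T -> U :=
  fun y => if y == x then u else f y.

(* Names of atomic propositions, agents and strategy variables are natural
   numbers. *)
Inductive formula : Type :=
| Atom (p : nat)
| Not (phi : formula)
| And (phi psi : formula)
| Or (phi psi : formula)
| Next (phi : formula)
| Until (phi psi : formula)
| Release (phi psi : formula)
| Ex (x : nat) (phi : formula)                 (* <<x>> phi *)
| All (x : nat) (phi : formula)                (* [[x]] phi *)
| Bind (a x : nat) (phi : formula).            (* (a, x) phi *)

(* [formula_over AP Ag phi]: phi uses only propositions in AP and agents in
   Ag. *)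
Fixpoint formula_over (AP Ag : {fset nat}) (phi : formula) : bool :=
  match phi with
  | Atom p => p \in AP
  | Not phi | Next phi | Ex _ phi | All _ phi => formula_over AP Ag phi
  | And phi psi | Or phi psi | Until phi psi | Release phi psi =>
      formula_over AP Ag phi && formula_over AP Ag psi
  | Bind a _ phi => (a \in Ag) && formula_over AP Ag phi
  end.

(* Placeholders are the objects that can carry a strategy: [inl x] is the
   variable x and [inr a] is the agent a. *)
Notation placeholder := (nat + nat)%type.

(* Free variables and agents.  A temporal operator refers to the play, hence to
   the strategies of all agents, so every agent of Ag is free in it. *)
Fixpoint free (Ag : {fset nat}) (phi : formula) : {fset placeholder} :=
  let agents : {fset placeholder} := [fset inr a | a in Ag] in
  match phi with
  | Atom _ => fset0
  | Not phi => free Ag phi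
  | And phi psi | Or phi psi => free Ag phi `|` free Ag psi
  | Next phi => agents `|` free Ag phi
  | Until phi psi | Release phi psi => agents `|` (free Ag phi `|` free Ag psi)
  | Ex x phi | All x phi => free Ag phi `\ inl x
  | Bind a x phi =>
      if inr a \in free Ag phi then inl x |` (free Ag phi `\ inr a)
      else free Ag phi
  end.

Definition sentence_over (AP Ag : {fset nat}) (phi : formula) : Prop :=
  formula_over AP Ag phi /\ free Ag phi = fset0.

Definition sentence (phi : formula) : Prop :=
  exists AP Ag : {fset nat},
    [/\ AP != fset0, Ag != fset0 & sentence_over AP Ag phi].

Record cgs : Type := Cgs {
  props : {fset nat};
  agents : {fset nat};
  action : countType;
  state : countType;
  label : state -> {fset nat};
  trans : state -> {ffun agents -> action} -> state;
  init : state;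
  props_neq0 : props != fset0;
  agents_neq0 : agents != fset0;
  action_neq0 : inhabited action;
  label_sub : forall s, label s `<=` props }.

Definition finite_type (T : eqType) : Prop := exists e : seq T, forall x, x \in e.

Definition finite_cgs (G : cgs) : Prop :=
  finite_type (action G) /\ finite_type (state G).

Section Semantics.

Variable G : cgs.

(* Histories are non-empty and listed from the oldest state to the current one.
   Strategies are total on lists, but only their values on histories that occur
   along plays are ever consulted. *)
Definition strategy : Type := seq (state G) -> action G.

Definition assignment : Type := placeholder -> option strategy.

Definition empty_assignment : assignment := fun _ => None.

(* [decision chi h d]: every agent has a strategy in chi, and d collects the
   actions these strategies choose after the history h. *)
Definition decision (chi : assignment) (h : seq (state G))
    (d : {ffun agents G -> action G}) : Prop :=
  forall a : agents G, exists2 f, chi (inr (val a)) = Some f & d a = f h.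

(* There is exactly one such pi when chi is defined on all agents, and none
   otherwise. *)
Definition play (chi : assignment) (s : state G) (pi : nat -> state G) : Prop :=
  pi 0 = s /\
  forall i, exists2 d, decision chi (mkseq pi i.+1) d & pi i.+1 = trans (pi i) d.

(* The assignment seen from pi i: a history h starting in pi i is extended with
   the past pi 0, ..., pi (i - 1). *)
Definition shift (chi : assignment) (pi : nat -> state G) (i : nat) : assignment :=
  fun l => omap (fun (f : strategy) h => f (mkseq pi i ++ h)) (chi l).

Fixpoint holds (chi : assignment) (s : state G) (phi : formula) : Prop :=
  match phi with
  | Atom p => p \in label s
  | Not phi => ~ holds chi s phi
  | And phi psi => holds chi s phi /\ holds chi s psi
  | Or phi psi => holds chi s phi \/ holds chi s psi
  | Next phi =>
      exists2 pi, play chi s pi & holds (shift chi pi 1) (pi 1) phi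
  | Until phi psi =>
      exists2 pi, play chi s pi &
      exists2 i, holds (shift chi pi i) (pi i) psi &
                 forall j, j < i -> holds (shift chi pi j) (pi j) phi
  | Release phi psi =>
      exists2 pi, play chi s pi &
      forall i, holds (shift chi pi i) (pi i) psi \/
                exists2 j, j < i & holds (shift chi pi j) (pi j) phi
  | Ex x phi =>
      exists f : strategy, holds (upd chi (inl x) (Some f)) s phi
  | All x phi =>
      forall f : strategy, holds (upd chi (inl x) (Some f)) s phi
  | Bind a x phi => holds (upd chi (inr a) (chi (inl x))) s phi
  end.

Definition models (phi : formula) : Prop := holds empty_assignment (init G) phi.

End Semantics.

Definition finitely_satisfiable (phi : formula) : Prop :=
  exists G : cgs,
    [/\ finite_cgs G, sentence_over (props G) (agents G) phi & models G phi].

(* Polish notation, as a word over nat. *)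
Fixpoint word (phi : formula) : seq nat :=
  match phi with
  | Atom p => [:: 0; p]
  | Not phi => 1 :: word phi
  | And phi psi => 2 :: word phi ++ word psi
  | Or phi psi => 3 :: word phi ++ word psi
  | Next phi => 4 :: word phi
  | Until phi psi => 5 :: word phi ++ word psi
  | Release phi psi => 6 :: word phi ++ word psi
  | Ex x phi => [:: 7, x & word phi]
  | All x phi => [:: 8, x & word phi]
  | Bind a x phi => [:: 9, a, x & word phi]
  end.

Definition encode (phi : formula) : nat := CodeSeq.code (word phi).

Lemma word_cat_inj phi psi s t :
  word phi ++ s = word psi ++ t -> phi = psi /\ s = t.
Proof.
elim: phi psi s t =>
  [p|f IHf|f IHf g IHg|f IHf g IHg|f IHf|f IHf g IHg|f IHf g IHg
  |x f IHf|x f IHf|a x f IHf] [q|f'|f' g'|f' g'|f'|f' g'|f' g'|y f'|y f'|b y f']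
  s t //=; rewrite -?catA.
- by case=> -> ->.
- by case=> /IHf[-> ->].
- by case=> /IHf[-> /IHg[-> ->]].
- by case=> /IHf[-> /IHg[-> ->]].
- by case=> /IHf[-> ->].
- by case=> /IHf[-> /IHg[-> ->]].
- by case=> /IHf[-> /IHg[-> ->]].
- by case=> -> /IHf[-> ->].
- by case=> -> /IHf[-> ->].
- by case=> -> -> /IHf[-> ->].
Qed.

Lemma encode_inj : injective encode.
Proof.
move=> phi psi /(can_inj CodeSeq.codeK) eq_w.
by case: (@word_cat_inj phi psi [::] [::]); rewrite ?cats0.
Qed.

(* [Inc i] increments register i.  [Dec i l] decrements register i if it is
   positive, and jumps to instruction l otherwise. *)
Inductive instr : Type :=
| Inc (i : nat)
| Dec (i l : nat).

Definition machine : Type := seq instr.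

Definition config : Type := (nat * (nat -> nat))%type.

Definition step (M : machine) (c : config) : config :=
  let: (pc, r) := c in
  match onth M pc with
  | Some (Inc i) => (pc.+1, upd r i (r i).+1)
  | Some (Dec i l) =>
      if r i is k.+1 then (pc.+1, upd r i k) else (l, r)
  | None => c
  end.

Definition start (n : nat) : config := (0, upd (fun _ => 0) 0 n).

(* Started on n in register 0, M halts (its program counter leaves the program)
   with m in register 0. *)
Definition outputs (M : machine) (n m : nat) : Prop :=
  exists k, let c := iter k (step M) (start n) in size M <= c.1 /\ c.2 0 = m.

(* The decision problem "given x satisfying D, does P x hold?", instances being
   presented through the encoding e.  Nothing is required of the machine on
   numbers that encode no instance. *)
Definition decidable_problem (T : Type) (e : T -> nat) (D P : T -> Prop) : Prop :=
  exists M : machine, forall x, D x ->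
    (P x -> outputs M (e x) 1) /\ (~ P x -> outputs M (e x) 0).

(* Main.v *)
(* With two agents, the sentences in which every strategy is consulted only at
   the initial state are the first-order sentences over finite structures with
   binary relations: an element is a first action, and a relation is the label
   of the state reached by a pair of actions.  As in Trakhtenbrot's theorem,
   such a sentence can say that a counter machine halts, because a strict order
   on a finite set has no infinite chain on which to write a diverging run.

   If M decided finite satisfiability, a sentence could say that M rejects that
   very sentence.  Let A say that P halts from the value held by variable 0, and
   let phi be A preceded by n blocks, each of which increases that value by 2,
   so that P starts from 2n.  A block is a prefix of the formula, hence acts on
   encodings as an affine function f, and encode phi = h (f^n (encode A)) with h
   affine.  Choose 2n = encode A: then P, whose code does not depend on n, can
   compute encode phi from its input, run M on it and halt if and only if M
   answers 0. *)

From mathcomp Require Import all_boot finmap zify.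
Require Import Defs.

Set Implicit Arguments.
Unset Strict Implicit.
Unset Printing Implicit Defensive.


(** * First-order sentences over binary relations *)

Section FirstOrder.

Local Open Scope fset_scope.

(** Negations and premises are atomic, hence decidable, so [tr] can turn an implication into a
    disjunction without classical logic. *)
Inductive fo : Type :=
| Rel (p x y : nat)
| NRel (p x y : nat)
| Imp (p x y : nat) (f : fo)
| Conj (f g : fo)
| Exi (x : nat) (f : fo)
| Fal (x : nat) (f : fo).

Fixpoint scoped (vs : seq nat) (f : fo) : bool :=
  match f with
  | Rel _ x y | NRel _ x y => (x \in vs) && (y \in vs)
  | Imp _ x y f => [&& x \in vs, y \in vs & scoped vs f]
  | Conj f g => scoped vs f && scoped vs g
  | Exi x f | Fal x f => scoped (x :: vs) f
  end.

Fixpoint symbols (f : fo) : seq nat :=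
  match f with
  | Rel p _ _ | NRel p _ _ => [:: p]
  | Imp p _ _ f => p :: symbols f
  | Conj f g => symbols f ++ symbols g
  | Exi _ f | Fal _ f => symbols f
  end.

Fixpoint eval (D : Type) (R : nat -> D -> D -> bool) (e : nat -> D) (f : fo) :
    Prop :=
  match f with
  | Rel p x y => R p (e x) (e y)
  | NRel p x y => ~ R p (e x) (e y)
  | Imp p x y f => R p (e x) (e y) -> eval R e f
  | Conj f g => eval R e f /\ eval R e g
  | Exi x f => exists d, eval R (upd e x d) f
  | Fal x f => forall d, eval R (upd e x d) f
  end.

Lemma eq_eval (D : Type) (R R' : nat -> D -> D -> bool) (e : nat -> D) (f : fo) :
  (forall p, p \in symbols f -> R p =2 R' p) -> eval R e f <-> eval R' e f.
Proof.
elim: f e => [p x y|p x y|p x y f IHf|f IHf g IHg|x f IHf|x f IHf] e /= eqR.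
- by rewrite eqR ?mem_head.
- by rewrite eqR ?mem_head.
- rewrite eqR ?mem_head // IHf // => q qf.
  by apply: eqR; rewrite inE qf orbT.
- rewrite IHf ?IHg // => q qf; apply: eqR; rewrite mem_cat qf ?orbT //.
- by split=> -[d /IHf Hd]; exists d; apply: Hd => q /eqR // H ? ?; rewrite H.
- by split=> H d; apply/IHf/H => // q qf ? ?; rewrite eqR.
Qed.

(* Elements are encoded by the first action of a strategy, and a relation p by
   the pairs of actions of agents 0 and 1 that lead to a state labelled p. *)
Definition rel (p x y : nat) : formula := Bind 0 x (Bind 1 y (Next (Atom p))).

Fixpoint tr (f : fo) : formula :=
  match f with
  | Rel p x y => rel p x y
  | NRel p x y => Not (rel p x y)
  | Imp p x y f => Or (Not (rel p x y)) (tr f)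
  | Conj f g => And (tr f) (tr g)
  | Exi x f => Ex x (tr f)
  | Fal x f => All x (tr f)
  end.

Definition duo : {fset nat} := [fset 0; 1].

Lemma duo_neq0 : duo != fset0.
Proof. by apply/fset0Pn; exists 0; rewrite !inE. Qed.

Lemma tr_over (AP : {fset nat}) f :
  {subset symbols f <= AP} -> formula_over AP duo (tr f).
Proof.
have in0 : 0 \in duo by rewrite !inE.
have in1 : 1 \in duo by rewrite !inE.
elim: f => [p x y|p x y|p x y f IHf|f IHf g IHg|x f IHf|x f IHf] //= sub;
  rewrite ?in0 ?in1 /= ?sub ?mem_head //.
- by apply: IHf => q qf; apply: sub; rewrite inE qf orbT.
- by rewrite IHf ?IHg // => q qf; apply: sub; rewrite mem_cat qf ?orbT.
Qed.

Lemma free_rel p x y : free duo (rel p x y) = [fset inl x; inl y].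
Proof.
have in0 : inr 0 \in [fset (inr a : placeholder) | a in duo].
  by apply: in_imfset; rewrite !inE.
have in1 : inr 1 \in [fset (inr a : placeholder) | a in duo].
  by apply: in_imfset; rewrite !inE.
rewrite /= fsetU0 in1 !inE in0 /=.
apply/fsetP => -[z|b]; rewrite !inE /=.
  case E: (_ \in _); rewrite ?andbF ?orbF //.
  by case/imfsetP: E.
apply/negbTE/negP => /and3P[b0 b1 /imfsetP[c]].
by rewrite !inE => Hc [bc]; case/orP: Hc b0 b1 => /eqP <-; rewrite bc eqxx.
Qed.

Lemma free_tr vs f l : scoped vs f -> l \in free duo (tr f) ->
  exists2 x, x \in vs & l = inl x.
Proof.
have free_relP ws p x y : x \in ws -> y \in ws -> l \in free duo (rel p x y) ->
    exists2 z, z \in ws & l = inl z.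
  by rewrite free_rel !inE => xw yw /orP[]/eqP->; [exists x | exists y].
have bindP ws x (A : {fset placeholder}) :
    (l \in A -> exists2 z, z \in x :: ws & l = inl z) ->
    l \in A `\ inl x -> exists2 z, z \in ws & l = inl z.
  move=> IH; rewrite in_fsetD1 => /andP[lx /IH[z]].
  by rewrite inE => /orP[/eqP-> lE|zw ->]; [rewrite lE eqxx in lx | exists z].
elim: f vs => [p x y|p x y|p x y f IHf|f IHf g IHg|x f IHf|x f IHf] vs /=.
- by case/andP; apply: free_relP.
- by case/andP; apply: free_relP.
- case/and3P=> xv yv sf; rewrite in_fsetU => /orP[|]; first exact: free_relP.
  exact: IHf.
- by case/andP=> sf sg; rewrite in_fsetU => /orP[]; [apply: IHf | apply: IHg].
- by move=> sf; apply: bindP; apply: IHf.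
- by move=> sf; apply: bindP; apply: IHf.
Qed.

Lemma tr_sentence_over (AP : {fset nat}) f :
  {subset symbols f <= AP} -> scoped [::] f -> sentence_over AP duo (tr f).
Proof.
move=> sub sf; split; first exact: tr_over.
apply/fsetP=> l; rewrite in_fset0; apply/negbTE/negP.
by case/(free_tr sf).
Qed.

Lemma tr_sentence f : scoped [::] f -> sentence (tr f).
Proof.
move=> sf; exists [fset p in 0 :: symbols f], duo; split=> //.
- by apply/fset0Pn; exists 0; rewrite !inE.
- exact: duo_neq0.
- by apply: tr_sentence_over => // p pf; rewrite !inE pf orbT.
Qed.

Lemma tr_over_agents (AP Ag : {fset nat}) f :
  formula_over AP Ag (tr f) -> (0 \in Ag) && (1 \in Ag).
Proof.
elim: f => [p x y|p x y|p x y f IHf|f IHf g IHg|x f IHf|x f IHf] //=.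
- by case/and3P=> ->.
- by case/and3P=> ->.
- by case/andP=> _ /IHf.
- by case/andP=> /IHf.
Qed.

(** [Next] makes every agent free and [rel] binds only 0 and 1, so a third agent would stay free.
    Hence a structure over which [tr f] is a sentence has exactly the agents of [duo]. *)
Lemma tr_free_agents (Ag : {fset nat}) f a :
  a \in Ag -> a \notin duo -> inr a \in free Ag (tr f).
Proof.
rewrite !inE negb_or => aA /andP[a0 a1].
have free_rel' p x y : inr a \in free Ag (rel p x y).
  have aI : inr a \in [fset (inr b : placeholder) | b in Ag] by apply: in_imfset.
  have ne b : a != b -> (inr a == inr b :> placeholder) = false.
    by move=> /negbTE nab; apply: nab.
  by rewrite /=; do !case: ifP => _; rewrite !inE /= ?ne //= aI ?orbT.
elim: f => [p x y|p x y|p x y f IHf|f IHf g IHg|x f IHf|x f IHf] /=.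
- exact: free_rel'.
- exact: free_rel'.
- by rewrite in_fsetU IHf orbT.
- by rewrite in_fsetU IHf.
- by rewrite !inE IHf.
- by rewrite !inE IHf.
Qed.

Lemma tr_agents (AP Ag : {fset nat}) f : sentence_over AP Ag (tr f) -> Ag = duo.
Proof.
case=> /tr_over_agents/andP[A0 A1] fr0; apply/fsetP => a.
apply/idP/idP => [aA|]; last by rewrite !inE => /orP[]/eqP->.
apply: contraT => /(tr_free_agents f aA).
by rewrite fr0.
Qed.

Section Evaluation.

Variable G : cgs.
Hypothesis duoG : agents G = duo.

Definition joint (u v : action G) : {ffun agents G -> action G} :=
  [ffun a => if val a == 0 then u else v].

Lemma holds_next_atom (chi : assignment G) fa fb s p :
  chi (inr 0) = Some fa -> chi (inr 1) = Some fb ->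
  holds chi s (Next (Atom p)) <->
  p \in label (trans s (joint (fa [:: s]) (fb [:: s]))).
Proof.
move=> chi0 chi1.
have decE h d : decision chi h d <-> d = joint (fa h) (fb h).
  split=> [dec|-> a].
    apply/ffunP=> a; rewrite ffunE; have [f] := dec a; case: a {dec} => a aG /=.
    have: a \in duo by rewrite -duoG.
    by rewrite !inE => /orP[]/eqP aE; rewrite {1}aE (chi0, chi1) => -[<-] ->;
      rewrite aE.
  rewrite ffunE; case: a => a aG /=.
  have: a \in duo by rewrite -duoG.
  by rewrite !inE => /orP[]/eqP->; [exists fa | exists fb].
split=> [[pi [pi0 /(_ 0)[d /decE -> pi1]]]|lp] /=; first by rewrite pi1 -pi0.
(* A play is infinite even if only its first step matters. It is built through its histories, since
   strategies read them whole. *)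
pose next h := rcons h (trans (last s h) (joint (fa h) (fb h))).
pose hist i := iter i next [:: s].
pose pi i := last s (hist i).
have histE i : mkseq pi i.+1 = hist i.
  elim: i => [|i IHi] //; rewrite mkseqS IHi /pi /hist iterS -/(hist i).
  by rewrite {2}/next last_rcons.
exists pi; first split=> // i.
  exists (joint (fa (hist i)) (fb (hist i))); first by rewrite histE; apply/decE.
  by rewrite {1}/pi /hist iterS last_rcons.
exact: lp.
Qed.

(** All atoms are evaluated one step after [s], so a strategy counts only through its action on
    [[:: s]]; conversely, a constant strategy realises any given action. *)
Lemma holds_tr (chi : assignment G) s (e : nat -> action G) vs f :
  scoped vs f ->
  (forall x, x \in vs -> omap (fun g => g [:: s]) (chi (inl x)) = Some (e x)) ->
  holds chi s (tr f) <->
  eval (fun p u v => p \in label (trans s (joint u v))) e f.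
Proof.
have holds_rel (c : assignment G) (ws : seq nat) (e' : nat -> action G) p x y :
    x \in ws -> y \in ws ->
    (forall x, x \in ws -> omap (fun g => g [:: s]) (c (inl x)) = Some (e' x)) ->
    @holds G c s (rel p x y) <-> p \in label (trans s (joint (e' x) (e' y))).
  move=> xw yw agree; have := agree _ xw; have := agree _ yw.
  case cy: (c (inl y)) => [fy|] // -[<-]; case cx: (c (inl x)) => [fx|] // -[<-].
  by apply: holds_next_atom; rewrite /upd /= ?cx ?cy.
have updP (c : assignment G) (ws : seq nat) (e' : nat -> action G) x
    (g : strategy G) :
    (forall z, z \in ws -> omap (fun g => g [:: s]) (c (inl z)) = Some (e' z)) ->
    forall z, z \in x :: ws ->
    omap (fun g => g [:: s]) (upd c (inl x) (Some g) (inl z)) =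
    Some (upd e' x (g [:: s]) z).
  move=> agree z; rewrite inE /upd.
  have -> : (inl z == inl x :> placeholder) = (z == x) by [].
  by case: eqVneq => //= _; apply: agree.
elim: f chi e vs => [p x y|p x y|p x y f IHf|f IHf g IHg|x f IHf|x f IHf]
  chi e vs /=.
- by case/andP=> xv yv agree; apply: holds_rel agree.
- by case/andP=> xv yv agree; have /= -> := holds_rel _ _ _ p _ _ xv yv agree.
- case/and3P=> xv yv sf agree.
  have /= -> := holds_rel _ _ _ p _ _ xv yv agree; rewrite (IHf _ _ _ sf agree).
  split=> [[]//|imp]; case E: (p \in _); last by left.
  by right; apply: imp.
- by case/andP=> sf sg agree; rewrite (IHf _ _ _ sf agree) (IHg _ _ _ sg agree).
- move=> sf agree; split=> [[g]|[d]].
    by rewrite (IHf _ _ _ sf (updP _ _ _ _ _ agree)); exists (g [:: s]).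
  by exists (fun=> d); rewrite (IHf _ _ _ sf (updP _ _ _ _ _ agree)).
- move=> sf agree; split=> H d.
    by have := H (fun=> d); rewrite (IHf _ _ _ sf (updP _ _ _ _ _ agree)).
  by rewrite (IHf _ _ _ sf (updP _ _ _ _ _ agree)).
Qed.

End Evaluation.

Lemma finitely_satisfiable_tr f : scoped [::] f ->
  finitely_satisfiable (tr f) <->
  exists (D : countType) (R : nat -> D -> D -> bool) (e : nat -> D),
    finite_type D /\ eval R e f.
Proof.
move=> sf; split=> [[G [[finA _] so]]|[D [R [e [finD ev]]]]].
  have duoG := tr_agents so; case: (action_neq0 G) => u.
  rewrite /models (holds_tr duoG (e := fun=> u) sf) // => ev.
  by do 2 eexists; exists (fun=> u); split; last exact: ev.
have agents_neq0 := duo_neq0.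
pose AP := [fset p in 0 :: symbols f].
have AP_neq0 : AP != fset0 by apply/fset0Pn; exists 0; rewrite !inE.
(* Besides the initial state [None], there is one state for each pair of actions; it records the
   pair just played and is labelled with the relations that hold of it. *)
pose St : countType := option (D * D).
pose lab (s : St) :=
  if s is Some uv then [fset p in AP | R p uv.1 uv.2] else fset0.
have lab_sub s : lab s `<=` AP.
  case: s => [uv|] /=; last exact: fsub0set.
  by apply/fsubsetP=> p; rewrite !inE => /andP[].
have in0 : 0 \in duo by rewrite !inE.
have in1 : 1 \in duo by rewrite !inE.
pose tau (s : St) (d : {ffun duo -> D}) : St :=
  Some (d (FSetSub in0), d (FSetSub in1)).
pose G := @Cgs AP duo D St lab tau None AP_neq0 agents_neq0 (inhabits (e 0)) lab_sub.
have [l lP] := finD.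
exists G; split.
- split=> //; exists (None :: [seq Some (u, v) | u <- l, v <- l]) => -[[u v]|] //.
  rewrite inE /=; apply/allpairsP; exists (u, v); split=> //; exact: lP.
- by apply: tr_sentence_over => // p pf; rewrite !inE pf orbT.
rewrite /models (holds_tr (erefl : agents G = duo) (e := e) sf) //.
apply/(eq_eval (R' := R)) => // p pf u v /=.
by rewrite !ffunE /= !inE pf orbT.
Qed.

End FirstOrder.

(** * Counter machines *)

(** Registers are compared pointwise, because different sequences of updates yield functions that
    are equal only extensionally. *)
Definition reaches (P : machine) (c c' : config) : Prop :=
  exists2 k, (iter k (step P) c).1 = c'.1 & (iter k (step P) c).2 =1 c'.2.

Definition halts (P : machine) (c : config) : Prop :=
  exists k, size P <= (iter k (step P) c).1.

Lemma iter_step_ext P k c c' : c.1 = c'.1 -> c.2 =1 c'.2 ->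
  (iter k (step P) c).1 = (iter k (step P) c').1 /\
  (iter k (step P) c).2 =1 (iter k (step P) c').2.
Proof.
move=> e1 e2; elim: k => [|k [IH1 IH2]] //=.
case: (iter k _ c) IH1 IH2 => pc r; case: (iter k _ c') => pc' r' /= -> eqr.
case: (onth P pc') => [[i|i l]|] //=.
  by split=> // j; rewrite /upd eqr; case: eqP.
by rewrite eqr; case: (r' i) => [|n] //=; split=> // j; rewrite /upd; case: eqP.
Qed.

Lemma reaches_refl P pc r r' : r =1 r' -> reaches P (pc, r) (pc, r').
Proof. by exists 0. Qed.

Lemma reaches_trans P c1 c2 c3 :
  reaches P c1 c2 -> reaches P c2 c3 -> reaches P c1 c3.
Proof.
case=> k e1 e2 [k' e1' e2']; exists (k' + k); rewrite iterD.
  by rewrite (iter_step_ext P k' e1 e2).1.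
by move=> j; rewrite (iter_step_ext P k' e1 e2).2.
Qed.

Lemma reaches_step P c : reaches P c (step P c).
Proof. by exists 1. Qed.

Lemma reaches_inc P pc r i : onth P pc = Some (Inc i) ->
  reaches P (pc, r) (pc.+1, upd r i (r i).+1).
Proof. by move=> Pi; have := reaches_step P (pc, r); rewrite /= Pi. Qed.

Lemma reaches_dec P pc r i l k : onth P pc = Some (Dec i l) -> r i = k.+1 ->
  reaches P (pc, r) (pc.+1, upd r i k).
Proof. by move=> Pi ri; have := reaches_step P (pc, r); rewrite /= Pi ri. Qed.

Lemma reaches_jump P pc r i l : onth P pc = Some (Dec i l) -> r i = 0 ->
  reaches P (pc, r) (l, r).
Proof. by move=> Pi ri; have := reaches_step P (pc, r); rewrite /= Pi ri. Qed.

Lemma step_halted P c : size P <= c.1 -> step P c = c.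
Proof. by case: c => pc r /= le; rewrite onth_default. Qed.

Lemma iter_step_halted P c k : size P <= c.1 -> iter k (step P) c = c.
Proof. by move=> le; elim: k => //= k ->; apply: step_halted. Qed.

Lemma iter_step_geq P c k k' : k <= k' -> size P <= (iter k (step P) c).1 ->
  iter k' (step P) c = iter k (step P) c.
Proof. by move=> /subnK <- le; rewrite iterD iter_step_halted. Qed.

Lemma halts_reaches P c c' : reaches P c c' -> halts P c <-> halts P c'.
Proof.
case=> k e1 e2; split=> -[k' le].
  (* If P halts before meeting [c'], then [c'] is itself halted, as halted configurations are fixed
     points. *)
  case: (leqP k' k) => [lek|/ltnW lek].
    by exists 0; rewrite /= -e1 (iter_step_geq lek).
  exists (k' - k); rewrite -(iter_step_ext P _ e1 e2).1 -iterD subnK //.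
by exists (k' + k); rewrite iterD (iter_step_ext P _ e1 e2).1.
Qed.

Definition code_at (P : machine) (o : nat) (B : seq instr) : Prop :=
  forall i ins, onth B i = Some ins -> onth P (o + i) = Some ins.

Lemma code_at_cat P o B C :
  code_at P o (B ++ C) -> code_at P o B /\ code_at P (o + size B) C.
Proof.
move=> at_o; split=> i ins Hi.
  by apply: at_o; rewrite onth_cat -onthTE Hi.
by rewrite -addnA; apply: at_o; rewrite onth_cat ltnNge leq_addr addKn.
Qed.

Lemma code_at_cons P o ins B :
  code_at P o (ins :: B) -> onth P o = Some ins /\ code_at P o.+1 B.
Proof.
rewrite -cat1s => /code_at_cat[/(_ 0 ins erefl)].
by rewrite addn0 addn1.
Qed.

Lemma reaches_nseq_inc P o i b r : code_at P o (nseq b (Inc i)) ->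
  reaches P (o, r) (o + b, upd r i (r i + b)).
Proof.
elim: b o r => [|b IHb] o r.
  by move=> _; rewrite !addn0; apply: reaches_refl => j; rewrite /upd; case: eqP => [->|].
case/code_at_cons=> Po /IHb IH.
apply: reaches_trans (reaches_inc r Po) _.
rewrite addnS -addSn; apply: reaches_trans (IH _) _.
by apply: reaches_refl => j; rewrite /upd eqxx addSnnS; case: eqP.
Qed.

(* Register 3 must hold 0: its decrement serves as an unconditional jump. *)
Definition transfer (o a x y : nat) : seq instr :=
  Dec x (o + a + 2) :: nseq a (Inc y) ++ [:: Dec 3 o].

Lemma size_transfer o a x y : size (transfer o a x y) = a + 2.
Proof. by rewrite /= size_cat size_nseq addn1 addn2. Qed.

Lemma reaches_transfer P o a x y r : code_at P o (transfer o a x y) ->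
  x != y -> x != 3 -> y != 3 -> r 3 = 0 ->
  reaches P (o, r) (o + a + 2, upd (upd r x 0) y (r y + a * r x)).
Proof.
case/code_at_cons=> P0 /code_at_cat[P1]; rewrite size_nseq.
case/code_at_cons=> P2 _ nxy nx3 ny3.
move rx: (r x) => n; elim: n r rx => [|n IHn] r rx r3.
  apply: reaches_trans (reaches_jump P0 rx) _; apply: reaches_refl => j.
  rewrite /upd muln0 addn0; case: eqP => [->|_] //.
  by case: eqP => [->|].
apply: reaches_trans (reaches_dec P0 rx) _.
apply: reaches_trans (reaches_nseq_inc _ P1) _.
apply: reaches_trans (reaches_jump P2 _) _.
  by rewrite /upd eq_sym (negbTE ny3) eq_sym (negbTE nx3).
apply: reaches_trans (IHn _ _ _) _.
- by rewrite /upd (negbTE nxy) eqxx.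
- by rewrite /upd eq_sym (negbTE ny3) eq_sym (negbTE nx3).
apply: reaches_refl => j; rewrite /upd eqxx (eq_sym y) (negbTE nxy).
by case: eqP => // _; [rewrite mulnS addnA | case: eqP].
Qed.

(** The [minn] redirects every jump out of M to the end of its block, so that halting becomes
    falling through to the code that follows. *)
Definition shift_instr (o z : nat) (ins : instr) : instr :=
  match ins with Inc i => Inc i | Dec i l => Dec i (o + minn l z) end.

Definition relocate (o : nat) (M : machine) : machine :=
  map (shift_instr o (size M)) M.

Lemma reaches_relocate P o M k pc r : code_at P o (relocate o M) ->
  pc <= size M ->
  let c := iter k (step M) (pc, r) in
  reaches P (o + pc, r) (o + minn c.1 (size M), c.2).
Proof.
move=> Po le_pc; elim: k => [|k /= IHk].
  by rewrite /= (minn_idPl le_pc); apply: reaches_refl.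
apply: reaches_trans IHk _; case: (iter k _ _) => q s /=.
(* Once M has halted, its iteration stands still and the simulation waits at the end of the
   block. *)
case Mq: (onth M q) => [ins|]; last exact: reaches_refl.
have lt_q : q < size M by rewrite -onthTE Mq.
have /Po : onth (relocate o M) q = Some (shift_instr o (size M) ins).
  by rewrite onth_map Mq.
rewrite (minn_idPl (ltnW lt_q)).
case: ins {Mq} => [i|i l] Pq.
  by rewrite (minn_idPl lt_q) addnS; apply: reaches_inc.
case ri: (s i) => [|n]; first exact: reaches_jump Pq ri.
by rewrite (minn_idPl lt_q) addnS; apply: reaches_dec Pq ri.
Qed.

Section Iterator.

(* Started with registers 1 and 2 holding 2n, the program computes
   [h (f^n (2n))] for [f m = a * m + b] and [h m = a' * m + b'] in register 0,
   runs M on it, and then halts if M has answered 0 and loops if it has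
   answered 1. *)
Variables (M : machine) (a b a' b' : nat).

Definition regs (i m : nat) : nat -> nat :=
  fun j => if j == 1 then i else if j == 2 then m else 0.

(** Each round takes 2 from register 1, so 2n gives n rounds. Register 0 collects [a] times register
    2 and is moved back, then [b] is added. The exit address is the size of the block. *)
Definition iteration : seq instr :=
  [:: Dec 1 (a + b + 8); Dec 1 (a + b + 8)] ++
  transfer 2 a 2 0 ++ transfer (a + 4) 1 0 2 ++ nseq b (Inc 2) ++ [:: Dec 3 0].

Definition prelude : seq instr :=
  iteration ++ transfer (a + b + 8) a' 2 0 ++ nseq b' (Inc 0).

(** At the two final instructions, 0 in register 0 exits the program, while 1 is decremented and the
    last instruction then jumps to itself forever. *)
Definition prog : machine :=
  prelude ++ relocate (size prelude) M ++
  [:: Dec 0 (size prelude + size M + 2); Dec 0 (size prelude + size M + 1)].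

Lemma size_iteration : size iteration = a + b + 8.
Proof. by rewrite /iteration !size_cat !size_transfer size_nseq /=; lia. Qed.

Lemma reaches_iteration P n m : code_at P 0 iteration ->
  reaches P (0, regs n.*2 m)
    (a + b + 8, regs 0 (iter n (fun m => a * m + b) m)).
Proof.
case/code_at_cons=> P0 /code_at_cons[P1] /code_at_cat[P2].
rewrite size_transfer => /code_at_cat[P3]; rewrite size_transfer.
case/code_at_cat=> P4; rewrite size_nseq => /code_at_cons[P5 _].
have e3 : 2 + (a + 2) = a + 4 by lia.
rewrite {}e3 in P3 P4 P5.
elim: n m => [|n IHn] m; first exact: reaches_jump P0 _.
rewrite iterSr doubleS.
apply: reaches_trans (reaches_dec P0 erefl) _.
apply: reaches_trans (reaches_dec P1 erefl) _.
apply: reaches_trans (reaches_transfer P2 _ _ _ _) _ => //.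
have e4 : 2 + a + 2 = a + 4 by lia.
rewrite e4; apply: reaches_trans (reaches_transfer P3 _ _ _ _) _ => //.
have e5 : a + 4 + 1 + 2 = a + 4 + (1 + 2) by lia.
rewrite e5; apply: reaches_trans (reaches_nseq_inc _ P4) _.
apply: reaches_trans (reaches_jump P5 _) _ => //.
apply: reaches_trans (IHn _); apply: reaches_refl => -[|[|[|j]]] //.
by rewrite /upd /regs /=; lia.
Qed.

Lemma reaches_prelude P n : code_at P 0 prelude ->
  reaches P (0, regs n.*2 n.*2) (size prelude,
    (start (a' * iter n (fun m => a * m + b) n.*2 + b')).2).
Proof.
case/code_at_cat=> P0; rewrite size_iteration => /code_at_cat[P1].
rewrite size_transfer add0n in P1 *; move=> P2.
apply: reaches_trans (reaches_iteration _ _ P0) _.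
apply: reaches_trans (reaches_transfer P1 _ _ _ _) _ => //.
rewrite -addnA; apply: reaches_trans (reaches_nseq_inc _ P2) _.
rewrite /prelude size_cat size_iteration size_cat size_transfer size_nseq !addnA.
by apply: reaches_refl => -[|[|[|j]]].
Qed.

Lemma reaches_prog n m :
  outputs M (a' * iter n (fun m => a * m + b) n.*2 + b') m ->
  exists2 r, r 0 = m &
    reaches prog (0, regs n.*2 n.*2) (size prelude + size M, r).
Proof.
have /code_at_cat[P0 /code_at_cat[P1 _]] : code_at prog 0 prog by [].
case=> k; set c := iter k _ _ => -[hc out]; exists c.2 => //.
apply: reaches_trans (reaches_prelude _ P0) _.
set r := (start _).2; have /= := reaches_relocate k r P1 (leq0n _).
by rewrite (_ : iter k _ _ = c) // (minn_idPr hc) add0n addn0.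
Qed.

Lemma size_prog : size prog = size prelude + size M + 2.
Proof. by rewrite /prog !size_cat size_map /= addnA. Qed.

Lemma onth_prog_tail : code_at prog (size prelude + size M)
  [:: Dec 0 (size prelude + size M + 2); Dec 0 (size prelude + size M + 1)].
Proof.
have /code_at_cat[_ /code_at_cat[_]] : code_at prog 0 prog by [].
by rewrite size_map.
Qed.

Lemma prog_halts n :
  outputs M (a' * iter n (fun m => a * m + b) n.*2 + b') 0 ->
  halts prog (0, regs n.*2 n.*2).
Proof.
case/reaches_prog=> r r0 re; apply/(halts_reaches re).
have /code_at_cons[P0 _] := onth_prog_tail.
by apply/(halts_reaches (reaches_jump P0 r0)); exists 0; rewrite size_prog.
Qed.

Lemma prog_loops n :
  outputs M (a' * iter n (fun m => a * m + b) n.*2 + b') 1 ->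
  ~ halts prog (0, regs n.*2 n.*2).
Proof.
case/reaches_prog=> r r1 re /(halts_reaches re).
have /code_at_cons[P0 /code_at_cons[P1 _]] := onth_prog_tail.
move/(halts_reaches (reaches_dec P0 r1)) => [k].
set c := (_, upd r 0 0).
have fixc : step prog c = c by rewrite /c /step P1 {1}/upd eqxx addn1.
rewrite iter_fix // size_prog addn2 => le.
by have := le : (size prelude + size M).+1 < (size prelude + size M).+1; rewrite ltnn.
Qed.

End Iterator.

(** * Finite models of halting runs *)

Lemma scoped_sub vs ws f : {subset vs <= ws} -> scoped vs f -> scoped ws f.
Proof.
have ext xs ys x :
    {subset xs <= ys} -> {subset (x : nat) :: xs <= x :: ys}.
  by move=> sub z; rewrite !inE => /orP[->|/sub->]; rewrite ?orbT.
elim: f vs ws => [p x y|p x y|p x y f IHf|f IHf g IHg|x f IHf|x f IHf] vs ws sub /=.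
- by case/andP=> /sub-> /sub->.
- by case/andP=> /sub-> /sub->.
- by case/and3P=> /sub-> /sub-> /IHf->.
- by case/andP=> /IHf-> // /IHg->.
- by apply: IHf; apply: ext.
- by apply: IHf; apply: ext.
Qed.

Definition top : fo := Fal 0 (Imp 0 0 0 (Rel 0 0 0)).

Definition conjs (s : seq nat) (F : nat -> fo) : fo :=
  foldr (fun x f => Conj (F x) f) top s.

Arguments conjs : simpl never.

Lemma scoped_conjs vs s F : (forall x, scoped vs (F x)) -> scoped vs (conjs s F).
Proof.
move=> sF; elim: s => [|x s IHs]; first exact: isT.
by apply/andP; split; [apply: sF | apply: IHs].
Qed.

Lemma eval_conjs (D : Type) (R : nat -> D -> D -> bool) e s F :
  eval R e (conjs s F) <-> forall x, x \in s -> eval R e (F x).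
Proof.
elim: s => [|x s IHs]; first by rewrite /conjs /=.
rewrite (_ : eval R e (conjs (x :: s) F) = (eval R e (F x) /\ eval R e (conjs s F))) //.
rewrite IHs; split=> [[Fx Fs] y|Fs].
  by rewrite inE => /orP[/eqP->|/Fs].
by split=> [|y ys]; apply: Fs; rewrite inE ?eqxx ?ys ?orbT.
Qed.

(* Relation symbols: 0 is the successor, 1 is "being zero" (on the diagonal), 2
   a strict order, [pc_sym l] holds at the times (on the diagonal) where the
   program counter is l, and [reg_sym i] holds at (v, t) if register i has
   value v at time t. *)
Definition pc_sym (l : nat) : nat := l.*2.+3.
Definition reg_sym (i : nat) : nat := i.*2.+4.

Arguments pc_sym : simpl never.
Arguments reg_sym : simpl never.

Definition register (ins : instr) : nat :=
  match ins with Inc i | Dec i _ => i end.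

Section Description.

Variable P : machine.

Definition nregs : nat := sumn (map register P) + 4.

Lemma register_lt l ins : onth P l = Some ins -> register ins < nregs.
Proof.
rewrite /nregs; elim: P l => [|ins' P' IH] [|l] //=.
  by case=> ->; lia.
by move/IH; lia.
Qed.

(* In the formulas below variable 1 is the current and 2 the next time. *)
Definition keep (q : pred nat) : fo :=
  conjs [seq j <- iota 0 nregs | q j]
    (fun j => Fal 3 (Imp (reg_sym j) 3 1 (Rel (reg_sym j) 3 2))).

Definition goto (l : nat) (f : fo) : fo :=
  Exi 2 (Conj (Rel 2 1 2) (Conj (Rel (pc_sym l) 2 2) f)).

Definition instr_rule (l : nat) (ins : instr) : fo :=
  match ins with
  | Inc i => goto l.+1 (Conj (keep (predC1 i))
      (Fal 3 (Imp (reg_sym i) 3 1 (Exi 4 (Conj (Rel 0 3 4) (Rel (reg_sym i) 4 2))))))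
  | Dec i l' => Conj
      (Fal 4 (Imp (reg_sym i) 4 1 (Imp 1 4 4 (goto l' (keep predT)))))
      (Fal 4 (Fal 5 (Imp (reg_sym i) 4 1 (Imp 0 5 4
         (goto l.+1 (Conj (keep (predC1 i)) (Rel (reg_sym i) 5 2)))))))
  end.

Definition rule (l : nat) : fo :=
  if onth P l is Some ins then Fal 1 (Imp (pc_sym l) 1 1 (instr_rule l ins))
  else top.

(** Variable 0, left free, stands for the input, which goes to registers 1 and 2 as in [regs]. *)
Definition initially : fo :=
  Exi 1 (Conj (Rel (pc_sym 0) 1 1) (Conj (Rel (reg_sym 1) 0 1)
    (Conj (Rel (reg_sym 2) 0 1) (Exi 2 (Conj (Rel 1 2 2)
      (conjs [seq j <- iota 0 nregs | j \notin [:: 1; 2]]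
        (fun j => Rel (reg_sym j) 2 1))))))).

Definition strict_order : fo :=
  Conj (Fal 1 (NRel 2 1 1))
    (Fal 1 (Fal 2 (Fal 3 (Imp 2 1 2 (Imp 2 2 3 (Rel 2 1 3)))))).

(** Values and successors are not forced to be unique. A model may contain spurious facts, but it
    contains those of the true run, in which every time before halting has a later one. *)
Definition run : fo :=
  Conj initially (Conj strict_order (conjs (iota 0 (size P)) rule)).

Lemma scoped_run : scoped [:: 0] run.
Proof.
have skeep q vs : 1 \in vs -> 2 \in vs -> scoped vs (keep q).
  by move=> v1 v2; apply: scoped_conjs => j /=; rewrite !inE v1 v2 !orbT.
apply/andP; split; first exact: scoped_conjs.
apply/andP; split=> //; apply: scoped_conjs => l.
by rewrite /rule; case: onth => [[i|i l']|] //=; rewrite !skeep.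
Qed.

(** * From a finite model to a halting run *)

Section Soundness.

Variables (D : eqType) (R : nat -> D -> D -> bool).

Fixpoint denotes (n : nat) (v : D) : Prop :=
  if n is n'.+1 then exists2 u, denotes n' u & R 0 u v else R 1 v v.

Definition describes (c : config) (t : D) : Prop :=
  R (pc_sym c.1) t t /\
  forall j, j < nregs -> exists2 v, denotes (c.2 j) v & R (reg_sym j) v t.

Lemma eval_keep e q :
  eval R e (keep q) <->
  forall j v, j < nregs -> q j -> R (reg_sym j) v (e 1) -> R (reg_sym j) v (e 2).
Proof.
rewrite eval_conjs; split=> H j.
  move=> v jK qj; have := H j; rewrite mem_filter qj mem_iota add0n.
  by move/(_ jK v).
by rewrite mem_filter mem_iota add0n => /andP[qj jK] v; apply: H.
Qed.

Lemma describes_step e c t :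
  eval R e (conjs (iota 0 (size P)) rule) -> c.1 < size P -> describes c t ->
  exists2 t', R 2 t t' & describes (step P c) t'.
Proof.
case: c => pc r /= /eval_conjs rules lt_pc [/= tpc treg].
have := rules pc; rewrite mem_iota add0n lt_pc /rule => /(_ isT).
case Pins: (onth P pc) => [ins|]; last by rewrite -onthTE Pins in lt_pc.
move=> /(_ t tpc); have iK := register_lt Pins.
have [v vr vt] := treg _ iK.
case: ins Pins iK v vr vt => [i|i l] /= Pins iK v vr vt.
  case=> t' [tt' [pct' [/eval_keep kp inc]]]; exists t' => //; split=> //= j jK.
  rewrite {1}/upd; case: eqVneq => [->|ji].
    by have [v' [vv' v't']] := inc v vt; exists v' => //; exists v.
  have [u ur ut] := treg j jK; exists u => //; exact: (kp j u jK).
case: (r i) vr => [|n] vr [jz dec].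
  have [t' [tt' [pct' /eval_keep kp]]] := jz v vt vr; exists t' => //.
  split=> //= j jK; have [u ur ut] := treg j jK; exists u => //.
  exact: (kp j u jK).
have [u un uv] := vr.
have [t' [tt' [pct' [/eval_keep kp ut']]]] := dec v u vt uv; exists t' => //.
split=> //= j jK; rewrite {1}/upd; case: eqVneq => [->|ji]; first by exists u.
have [w wr wt] := treg j jK; exists w => //; exact: (kp j w jK).
Qed.

(** If P never halted, [describes_step] would prolong the chain of times at will, whereas the
    entries of a chain for a strict order are distinct and the domain is finite. *)
Lemma run_halts e n : finite_type D -> denotes n (e 0) -> eval R e run ->
  ~ ~ halts P (0, regs n n).
Proof.
case=> D_list D_listP e0 [init [[irr trans] rules]] no_halt.
have lt_pc k : (iter k (step P) (0, regs n n)).1 < size P.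
  by rewrite ltnNge; apply/negP => le; apply: no_halt; exists k.
have [t0 t0P] : exists t, describes (0, regs n n) t.
  case: init => t [tpc [r1t [r2t [z [z0 /eval_conjs zt]]]]]; exists t; split=> //= j jK.
  rewrite /regs; case: eqVneq => [->|j1]; first by exists (e 0).
  case: eqVneq => [->|j2]; first by exists (e 0).
  by exists z => //; apply: zt; rewrite mem_filter mem_iota jK !inE negb_or j1 j2.
have chain m k t : describes (iter k (step P) (0, regs n n)) t ->
    exists2 s, path (R 2) t s & size s = m.
  elim: m k t => [|m IHm] k t tP; first by exists [::].
  have [t' tt' /(IHm k.+1)[s s_path s_size]] := describes_step rules (lt_pc k) tP.
  by exists (t' :: s); rewrite /= ?tt' ?s_size.
(* Together with [t0], the chain has one entry more than [D_list]. *)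
have [s s_path s_size] := chain (size D_list) 0 t0 t0P.
have tr2 : transitive (R 2) by move=> y x z; apply: (trans x y z).
have ir2 : irreflexive (R 2) by move=> x; apply/negbTE/negP/irr.
have := @uniq_leq_size _ (t0 :: s) D_list (@sorted_uniq _ _ tr2 ir2 (t0 :: s) s_path).
by rewrite /= s_size ltnn => /(_ (fun x _ => D_listP x)).
Qed.

End Soundness.

(** * From a halting run to a finite model *)

Section Completeness.

Variables n T : nat.
Definition run_at (t : nat) : config := iter t (step P) (0, regs n n).
Hypothesis halted : size P <= (run_at T).1.

Local Notation bound := (n + T).

(** The numbers up to n + T serve both as times and as values: P has halted at time T, and a
    register holds at most n + t at time t. After the shift by 3, even symbols are program counters
    and odd ones registers. *)
Definition table (p : nat) (u v : 'I_bound.+1) : bool :=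
  match p with
  | 0 => v == u.+1 :> nat
  | 1 => u == 0 :> nat
  | 2 => u < v
  | p.+3 => if odd p then (run_at v).2 p./2 == u else (run_at v).1 == p./2
  end.

Arguments table : simpl never.

Lemma table_pc l u t : table (pc_sym l) u t = ((run_at t).1 == l).
Proof. by rewrite /table /= odd_double doubleK. Qed.

Lemma table_reg i v t : table (reg_sym i) v t = ((run_at t).2 i == v).
Proof. by rewrite /table /= odd_double uphalf_double. Qed.

Definition tableE := (table_pc, table_reg,
  fun u v => erefl : table 0 u v = (v == u.+1 :> nat),
  fun u v => erefl : table 1 u v = (u == 0 :> nat),
  fun u v => erefl : table 2 u v = (u < v)).

Lemma run_at_bound t i : (run_at t).2 i <= n + t.
Proof.
elim: t i => [|t IHt] i; first by rewrite /= /regs; do !case: ifP => _; lia.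
rewrite /run_at iterS -/(run_at t); case: (run_at t) IHt => pc r /= IHt.
have le j : r j <= n + t.+1 by apply: leq_trans (IHt j) _; lia.
case: onth => [[j|j l]|] //=; first by rewrite /upd; case: eqP => // _; have := IHt j; lia.
case rj: (r j) => [|k] //=; rewrite /upd; case: eqP => // _.
by have := le j; lia.
Qed.

Lemma run_at_lt t : (run_at t).1 < size P -> t < T.
Proof.
by move=> lt; rewrite ltnNge; apply: contraTN lt => /(iter_step_geq)/(_ halted);
  rewrite -leqNgt /run_at => ->.
Qed.

Lemma eval_goto e l f (t : 'I_bound.+1) :
  (run_at t).1 < size P -> e 1 = t -> (run_at t.+1).1 = l ->
  (forall t' : 'I_bound.+1, t' = t.+1 :> nat -> eval table (upd e 2 t') f) ->
  eval table e (goto l f).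
Proof.
move=> /run_at_lt tT et pcl ft.
have lt : t.+1 < bound.+1 by rewrite ltnS; apply: leq_trans tT (leq_addl _ _).
exists (Ordinal lt); rewrite /upd /= et !tableE /= pcl eqxx.
by split=> //; split=> //; apply: ft.
Qed.

Lemma eval_keep_run e (q : pred nat) (t t' : 'I_bound.+1) : e 1 = t -> e 2 = t' ->
  (forall j, q j -> (run_at t').2 j = (run_at t).2 j) -> eval table e (keep q).
Proof.
by move=> et et' kp; apply/eval_keep => j v _ /kp; rewrite et et' !tableE => ->.
Qed.

Lemma eval_instr_rule e l ins (t : 'I_bound.+1) :
  onth P l = Some ins -> e 1 = t -> (run_at t).1 = l ->
  eval table e (instr_rule l ins).
Proof.
move=> Pl et tl.
have lt : (run_at t).1 < size P by rewrite tl -onthTE Pl.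
have tT := run_at_lt lt.
have st : run_at t.+1 = step P (run_at t) by [].
case rt: (run_at t) tl => [pc r] /= pcl.
rewrite rt /step pcl Pl in st.
have r_eq j v : table (reg_sym j) v t = (r j == v) by rewrite tableE rt.
case: ins Pl st => [i|i l'] Pl st.
  apply: (eval_goto lt et); first by rewrite st.
  move=> t' t'E; split.
    apply: (@eval_keep_run _ _ t t') => // j /negbTE/= ji.
    by rewrite t'E st rt /= /upd ji.
  move=> v; rewrite /= /upd /= et r_eq => /eqP rv.
  have ltv : v.+1 < bound.+1.
    by have := run_at_bound t i; rewrite rt /= rv; lia.
  exists (Ordinal ltv); rewrite !tableE /=; split=> //.
  by rewrite t'E st /= /upd eqxx rv.
split=> v.
  move=> vt v0; have /eqP rv : r i == v by rewrite -r_eq -et; exact: vt.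
  have /eqP {}v0 : v == 0 :> nat by exact: v0.
  rewrite rv v0 in st.
  apply: (eval_goto lt) => //; first by rewrite st.
  move=> t' t'E; apply: (@eval_keep_run _ _ t t') => // j _.
  by rewrite t'E st rt.
move=> u vt vu; have /eqP rv : r i == v by rewrite -r_eq -et; exact: vt.
have /eqP {}vu : v == u.+1 :> nat by exact: vu.
rewrite rv vu in st; rewrite -/(eval _ _ _).
apply: (eval_goto lt) => //; first by rewrite st.
move=> t' t'E; split.
  apply: (@eval_keep_run _ _ t t') => // j /negbTE/= ji.
  by rewrite t'E st rt /= /upd ji.
by rewrite /= tableE t'E st /= /upd eqxx.
Qed.

Lemma eval_run (e : nat -> 'I_bound.+1) : e 0 = n :> nat -> eval table e run.
Proof.
move=> e0; split; last split.
(* The first [ord0] is the initial time, the second one the value zero. *)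
- exists ord0; rewrite /= !tableE /upd /= e0.
  do 3 split=> //; exists ord0; split=> //.
  apply/eval_conjs => j; rewrite mem_filter !inE negb_or => /andP[/andP[j1 j2] _].
  by rewrite /= tableE /= /regs (negbTE j1) (negbTE j2).
- by split=> [u|u v w] /=; rewrite !tableE /upd /= ?ltnn //; apply: ltn_trans.
- apply/eval_conjs => l _; rewrite /rule; case Pl: onth => [ins|]; last by move=> t.
  by move=> t; rewrite /= /upd /= tableE => /eqP; apply: eval_instr_rule.
Qed.

End Completeness.

End Description.

(** * Self-reference *)

Definition from_zero (f : fo) : fo := Exi 0 (Conj (Rel 1 0 0) f).

(* Two successor steps bring the new element back to variable 0: this makes the
   encoding of the iterates an affine function of that of f. *)
Definition two_steps (f : fo) : fo :=
  Exi 1 (Conj (Rel 0 0 1) (Exi 0 (Conj (Rel 0 1 0) f))).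

Definition halting (P : machine) (n : nat) : fo :=
  from_zero (iter n two_steps (run P)).

Lemma scoped_halting P n : scoped [::] (halting P n).
Proof.
rewrite /=; elim: n => [|n IHn]; first exact: scoped_run.
by apply: scoped_sub IHn => x; rewrite !inE => ->; rewrite orbT.
Qed.

Lemma denotes_two_steps (D : eqType) (R : nat -> D -> D -> bool) n m f e :
  denotes R m (e 0) -> eval R e (iter n two_steps f) ->
  exists2 e', denotes R (n.*2 + m) (e' 0) & eval R e' f.
Proof.
elim: n m e => [|n IHn] m e em; first by exists e.
case=> u [eu [v [uv /IHn]]]; move/(_ m.+2) => H.
rewrite doubleS !addSnnS; apply: H; exists u => //; by exists (e 0).
Qed.

Lemma eval_two_steps P k T n m f (e : nat -> 'I_(k + T).+1) :
  (forall e' : nat -> 'I_(k + T).+1, e' 0 = n.*2 + m :> nat -> eval (@table P k T) e' f) ->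
  n.*2 + m <= k + T -> e 0 = m :> nat ->
  eval (@table P k T) e (iter n two_steps f).
Proof.
elim: n m e => [|n IHn] m e ef le em; first exact: ef.
have lt1 : m.+1 < (k + T).+1 by lia.
have lt2 : m.+2 < (k + T).+1 by lia.
exists (Ordinal lt1); rewrite /upd /= em eqxx; split=> //.
exists (Ordinal lt2); rewrite eqxx; split=> //.
apply: (IHn m.+2) => //; last by lia.
by move=> e' e'E; apply: ef; rewrite e'E; lia.
Qed.

Lemma halting_sat P n : finitely_satisfiable (tr (halting P n)) ->
  ~ ~ halts P (0, regs n.*2 n.*2).
Proof.
case/(finitely_satisfiable_tr (scoped_halting P n))=> D [R [e [finD]]].
case=> z [z0 /(@denotes_two_steps _ _ _ 0)] [//|e'].
by rewrite addn0; apply: run_halts.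
Qed.

Lemma sat_halting P n : halts P (0, regs n.*2 n.*2) ->
  finitely_satisfiable (tr (halting P n)).
Proof.
case=> T haltT; apply/(finitely_satisfiable_tr (scoped_halting P n)).
exists 'I_(n.*2 + T).+1, (@table P n.*2 T), (fun=> ord0); split.
  by exists (enum 'I_(n.*2 + T).+1) => x; rewrite mem_enum.
exists ord0; split=> //; apply: (@eval_two_steps _ _ _ _ 0) => //; last by lia.
by move=> e'; rewrite addn0; apply: eval_run.
Qed.

(** Putting the letter x in front of a word with code c gives the code 2^x (2c + 1), and affine maps
    compose. *)
Lemma code_cat_affine s :
  exists a b, forall t, CodeSeq.code (s ++ t) = a * CodeSeq.code t + b.
Proof.
elim: s => [|x s [a [b IHs]]]; first by exists 1, 0 => t; rewrite mul1n addn0.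
exists (2 ^ x * a.*2), (2 ^ x * b.*2.+1) => t /=.
by rewrite IHs -!muln2; lia.
Qed.

(** The coefficients are chosen before P, so they can be built into the program P without
    circularity. *)
Lemma encode_halting : exists a b a' b', forall P n,
  encode (tr (halting P n)) =
  a' * iter n (fun m => a * m + b) (encode (tr (run P))) + b'.
Proof.
(* These two words are the Polish prefixes that [two_steps] and [from_zero] put before a formula. *)
have [a [b ab]] := code_cat_affine
  [:: 7; 1; 2; 9; 0; 0; 9; 1; 1; 4; 0; 0; 7; 0; 2; 9; 0; 1; 9; 1; 0; 4; 0; 0].
have [a' [b' ab']] := code_cat_affine [:: 7; 0; 2; 9; 0; 0; 9; 1; 0; 4; 0; 1].
exists a, b, a', b' => P n; have <- : encode (tr (iter n two_steps (run P))) =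
    iter n (fun m => a * m + b) (encode (tr (run P))).
  by elim: n => //= n <-; apply: ab.
exact: ab'.
Qed.

(** The leading letter 2 contributes a factor 4. As [tr (run P)] is a conjunction, its code can be
    reached by blocks that add 2. *)
Lemma encode_And_even phi psi : exists n, encode (And phi psi) = n.*2.
Proof.
exists (2 * (CodeSeq.code (word phi ++ word psi)).*2.+1).
by rewrite /encode /= -muln2; lia.
Qed.

Theorem theorem4p3 : ~ decidable_problem encode sentence finitely_satisfiable.
Proof.
case=> M decM; have [a [b [a' [b' enc]]]] := encode_halting.
pose P := prog M a b a' b'.
(* With this n, the input 2n of P is the code of [tr (run P)], from which P computes the code of
   [tr (halting P n)]. *)
have [n run_n] : exists n, encode (tr (run P)) = n.*2.
  exact: encode_And_even.
have := decM _ (tr_sentence (scoped_halting P n)); rewrite enc run_n.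
case=> sat_out unsat_out.
(* A model would make M answer 1 and P loop, although a model excludes looping. So M answers 0 and P
   halts, which yields a model after all. *)
have unsat : ~ finitely_satisfiable (tr (halting P n)).
  by move=> sat; apply: (halting_sat sat); apply/prog_loops/sat_out.
by apply/unsat/sat_halting/prog_halts/unsat_out.
Qed.
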